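(* Let $R$ and $S$ be commutative unital rings, $\mathbb{A}$ an $R$-algebra and $\mathbb{B}$ an $S$-algebra (neither assumed unital), with unitalizations $\widehat{\mathbb{A}}$ and $\widehat{\mathbb{B}}$. To every $\mathbb{A}$-$\mathbb{B}$-bimodule $M$ associate the unital $\widehat{\mathbb{A}}$-$\widehat{\mathbb{B}}$-bimodule $F(M)$ which has the same underlying additive group as $M$ and external laws $$(a,r).m = a.m + r.m, \qquad m.(b,s) = m.b + m.s$$ for $a\in\mathbb{A}$, $r\in R$, $b\in\mathbb{B}$, $s\in S$, $m\in M$. To every morphism $f:M\to N$ of $\mathbb{A}$-$\mathbb{B}$-bimodules associate $F(f)=f$. Then $F$ is an isomorphism of categories from the category ${}_{\mathbb{A}}\mathrm{Mod}_{\mathbb{B}}$ of $\mathbb{A}$-$\mathbb{B}$-bimodules to the category ${}_{\widehat{\mathbb{A}}}\mathrm{UMod}_{\widehat{\mathbb{B}}}$ of unital $\widehat{\mathbb{A}}$-$\widehat{\mathbb{B}}$-bimodules.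
   Context: For a commutative unital ring $R$, an $R$-algebra $\mathbb{A}$ (not assumed unital) is a unital left $R$-module with an associative $R$-bilinear multiplication. A left $\mathbb{A}$-module is an abelian group $M$ with a unital left $R$-module structure and a biadditive action $\mathbb{A}\times M\to M$ such that $a.(b.m)=(ab).m$ and $r.(a.m)=(r.a).m=a.(r.m)$ for $a,b\in\mathbb{A}$, $r\in R$, $m\in M$. Right modules over an $S$-algebra $\mathbb{B}$ are defined symmetrically: a unital right $S$-module structure and a biadditive action with $(m.b).b'=m.(bb')$ and $(m.b).s=m.(s.b)=(m.s).b$. An $\mathbb{A}$-$\mathbb{B}$-bimodule is an abelian group $M$ that is both a left $\mathbb{A}$-module and a right $\mathbb{B}$-module and such that the left actions of $\mathbb{A}$ and of $R$ each commute with the right actions of $\mathbb{B}$ and of $S$. Bimodule homomorphisms are additive maps compatible with the left actions of $\mathbb{A}$ and $R$ and the right actions of $\mathbb{B}$ and $S$. The unitalization $\widehat{\mathbb{A}}$ of an $R$-algebra $\mathbb{A}$ is the abelian group $\mathbb{A}\times R$ with product $(a,r)(b,s)=(ab+r.b+a.s,\,rs)$ (where $a.s:=s.a$); it is a unital $R$-algebra with unit $(0,1)$. For unital algebras $A,B$, ${}_A\mathrm{UMod}_B$ is the category of unital $A$-$B$-bimodules, i.e. bimodules in the usual sense over the unital rings $A$ and $B$. *)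

(* Defs.v *)
From HB Require Import structures.
From mathcomp Require Import all_boot all_algebra.
From mathcomp Require Import boolp.

Set Implicit Arguments.
Unset Strict Implicit.
Unset Printing Implicit Defensive.

Import GRing.Theory.
Local Open Scope ring_scope.

(* pzRingType and comPzRingType, unlike the nz variants, include the zero
   ring. *)

Record category := Category {
  obj :> Type;
  mor : obj -> obj -> Type;
  idm : forall x, mor x x;
  compm : forall x y z, mor y z -> mor x y -> mor x z;
  compmA : forall w x y z (h : mor y z) (g : mor x y) (f : mor w x),
    compm h (compm g f) = compm (compm h g) f;
  comp1m : forall x y (f : mor x y), compm (idm y) f = f;
  compm1 : forall x y (f : mor x y), compm f (idm x) = f
}.

Record functor (C D : category) := Functor {
  fobj :> C -> D;
  fhom : forall x y, mor x y -> mor (fobj x) (fobj y);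
  fhom_id : forall x, fhom (idm x) = idm (fobj x);
  fhom_comp : forall x y z (g : mor y z) (f : mor x y),
    fhom (compm g f) = compm (fhom g) (fhom f)
}.

Definition functor_id (C : category) : functor C C :=
  @Functor C C (fun x => x) (fun _ _ f => f)
    (fun _ => erefl) (fun _ _ _ _ _ => erefl).

Section FunctorComp.
Variables (C D E : category) (G : functor D E) (F : functor C D).

Fact functor_comp_id x : fhom G (fhom F (idm x)) = idm (G (F x)).
Proof. by rewrite !fhom_id. Qed.

Fact functor_comp_comp x y z (g : mor y z) (f : mor x y) :
  fhom G (fhom F (compm g f)) = compm (fhom G (fhom F g)) (fhom G (fhom F f)).
Proof. by rewrite !fhom_comp. Qed.

Definition functor_comp : functor C E :=
  @Functor C E (fun x => G (F x)) (fun _ _ f => fhom G (fhom F f))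
    functor_comp_id functor_comp_comp.
End FunctorComp.

(* Isomorphism, not equivalence: both composites are equal to the identity
   functors, on objects as well as on morphisms. *)
Definition is_category_iso (C D : category) (F : functor C D) : Prop :=
  exists G : functor D C,
    functor_comp G F = functor_id C /\ functor_comp F G = functor_id D.

(* MathComp's own algebra structures all have a unit. *)
HB.mixin Record Lmodule_isNuAlgebra (R : comPzRingType) A of GRing.Lmodule R A := {
  numul : A -> A -> A;
  numulA : forall a b c : A, numul a (numul b c) = numul (numul a b) c;
  numulDl : forall a b c : A, numul (a + b) c = numul a c + numul b c;
  numulDr : forall a b c : A, numul a (b + c) = numul a b + numul a c;
  nuscaleAl : forall (r : R) (a b : A), r *: numul a b = numul (r *: a) b;
  nuscaleAr : forall (r : R) (a b : A), r *: numul a b = numul a (r *: b)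
}.

#[short(type="nuAlgType")]
HB.structure Definition NuAlgebra (R : comPzRingType) :=
  {A of GRing.Lmodule R A & Lmodule_isNuAlgebra R A}.

Definition unitalization (R : comPzRingType) (A : nuAlgType R) : Type :=
  (A * R)%type.

Section Unitalization.
Variables (R : comPzRingType) (A : nuAlgType R).

HB.instance Definition _ :=
  GRing.Zmodule.copy (unitalization A) (A * R)%type.

Definition unit_one : unitalization A := (0, 1).
(* In (a,r)(b,s) = (ab + r.b + a.s, rs) the right action is a.s := s.a. *)
Definition unit_mul (x y : unitalization A) : unitalization A :=
  (numul x.1 y.1 + x.2 *: y.1 + y.2 *: x.1, x.2 * y.2).

Fact numul0l (a : A) : numul 0 a = 0.
Proof. by apply: (addrI (numul 0 a)); rewrite -numulDl !addr0. Qed.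

Fact numul0r (a : A) : numul a 0 = 0.
Proof. by apply: (addrI (numul a 0)); rewrite -numulDr !addr0. Qed.

Fact unit_mulA : associative unit_mul.
Proof.
move=> [a r] [b s] [c t]; congr pair => /=; last exact: mulrA.
rewrite !(numulDl, numulDr, scalerDr) numulA -!nuscaleAr -!nuscaleAl !scalerA.
rewrite (mulrC t r) (mulrC t s) -!addrA; congr (_ + _).
rewrite [RHS]addrCA; congr (_ + _).
rewrite [RHS]addrCA [X in _ = _ + X]addrCA [RHS]addrCA; congr (_ + _).
exact: addrCA.
Qed.

Fact unit_mul1l : left_id unit_one unit_mul.
Proof.
move=> [a r]; congr pair; last exact: mul1r.
by rewrite /= numul0l scale1r scaler0 add0r addr0.
Qed.

Fact unit_mul1r : right_id unit_one unit_mul.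
Proof.
move=> [a r]; congr pair; last exact: mulr1.
by rewrite /= numul0r scale1r scaler0 !add0r.
Qed.

Fact unit_mulDl : left_distributive unit_mul +%R.
Proof.
move=> [a r] [b s] [c t]; congr pair; last exact: mulrDl.
by rewrite /= numulDl scalerDl scalerDr [RHS]addrACA [X in _ = X + _]addrACA.
Qed.

Fact unit_mulDr : right_distributive unit_mul +%R.
Proof.
move=> [a r] [b s] [c t]; congr pair; last exact: mulrDr.
by rewrite /= numulDr scalerDl scalerDr [RHS]addrACA [X in _ = X + _]addrACA.
Qed.

HB.instance Definition _ := GRing.Zmodule_isPzRing.Build (unitalization A)
  unit_mulA unit_mul1l unit_mul1r unit_mulDl unit_mulDr.

End Unitalization.

(* A bimodule carries several module structures on one abelian group and
   objects have to be compared by equality, so the laws are kept unbundled.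
   The conditions of is_lmod are those of GRing.Zmodule_isLmodule. *)

Record is_lmod (R : pzRingType) (M : zmodType) (sc : R -> M -> M) : Prop :=
  IsLmod {
    lscA : forall r s m, sc r (sc s m) = sc (r * s) m;
    lsc1 : forall m, sc 1 m = m;
    lscDr : forall r m n, sc r (m + n) = sc r m + sc r n;
    lscDl : forall r s m, sc (r + s) m = sc r m + sc s m
  }.

Record is_rmod (S : pzRingType) (M : zmodType) (sc : M -> S -> M) : Prop :=
  IsRmod {
    rscA : forall m s t, sc (sc m s) t = sc m (s * t);
    rsc1 : forall m, sc m 1 = m;
    rscDl : forall m n s, sc (m + n) s = sc m s + sc n s;
    rscDr : forall m s t, sc m (s + t) = sc m s + sc m t
  }.

Record is_nu_lmod (R : comPzRingType) (A : nuAlgType R) (M : zmodType)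
    (sc : R -> M -> M) (act : A -> M -> M) : Prop := IsNuLmod {
  nul_lmod : is_lmod sc;
  nulA : forall a b m, act a (act b m) = act (numul a b) m;
  nulDr : forall a m n, act a (m + n) = act a m + act a n;
  nulDl : forall a b m, act (a + b) m = act a m + act b m;
  nul_scl : forall r a m, sc r (act a m) = act (r *: a) m;
  nul_scr : forall r a m, act (r *: a) m = act a (sc r m)
}.

Record is_nu_rmod (S : comPzRingType) (B : nuAlgType S) (M : zmodType)
    (sc : M -> S -> M) (act : M -> B -> M) : Prop := IsNuRmod {
  nur_rmod : is_rmod sc;
  nurA : forall m b c, act (act m b) c = act m (numul b c);
  nurDl : forall m n b, act (m + n) b = act m b + act n b;
  nurDr : forall m b c, act m (b + c) = act m b + act m c;
  nur_scr : forall m b s, sc (act m b) s = act m (s *: b);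
  nur_scl : forall m b s, act m (s *: b) = act (sc m s) b
}.

Record bimod (R S : comPzRingType) (A : nuAlgType R) (B : nuAlgType S) :=
  Bimod {
    bim :> zmodType;
    bim_lsc : R -> bim -> bim;
    bim_lact : A -> bim -> bim;
    bim_rsc : bim -> S -> bim;
    bim_ract : bim -> B -> bim;
    bim_lmod : is_nu_lmod bim_lsc bim_lact;
    bim_rmod : is_nu_rmod bim_rsc bim_ract;
    bim_lact_ract : forall a m b,
      bim_ract (bim_lact a m) b = bim_lact a (bim_ract m b);
    bim_lact_rsc : forall a m s,
      bim_rsc (bim_lact a m) s = bim_lact a (bim_rsc m s);
    bim_lsc_ract : forall r m b,
      bim_ract (bim_lsc r m) b = bim_lsc r (bim_ract m b);
    bim_lsc_rsc : forall r m s,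
      bim_rsc (bim_lsc r m) s = bim_lsc r (bim_rsc m s)
  }.

Section BimodCategory.
Variables (R S : comPzRingType) (A : nuAlgType R) (B : nuAlgType S).
Implicit Types M N P : bimod A B.

Record bimod_hom M N := BimodHom {
  bhom :> {additive M -> N};
  bhom_lact : forall a m, bhom (bim_lact a m) = bim_lact a (bhom m);
  bhom_lsc : forall r m, bhom (bim_lsc r m) = bim_lsc r (bhom m);
  bhom_ract : forall m b, bhom (bim_ract m b) = bim_ract (bhom m) b;
  bhom_rsc : forall m s, bhom (bim_rsc m s) = bim_rsc (bhom m) s
}.

Fact additive_inj (U V : zmodType) (f g : {additive U -> V}) :
  f =1 g -> f = g.
Proof.
case: f g => f [[f0]] [g [[g0]]] /= /funext efg; subst g.
by rewrite (Prop_irrelevance f0 g0).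
Qed.

Fact bimod_hom_inj M N (f g : bimod_hom M N) : f =1 g -> f = g.
Proof.
case: f g => [f f1 f2 f3 f4] [g g1 g2 g3 g4] /= /additive_inj efg.
by subst g; congr BimodHom; apply: Prop_irrelevance.
Qed.

Definition bimod_id M : bimod_hom M M :=
  @BimodHom M M idfun (fun _ _ => erefl) (fun _ _ => erefl)
    (fun _ _ => erefl) (fun _ _ => erefl).

Definition bimod_comp M N P (g : bimod_hom N P) (f : bimod_hom M N) :
  bimod_hom M P.
Proof.
by exists (g \o f : {additive M -> P}) => [a m|r m|m b|m s] /=;
  rewrite ?(bhom_lact, bhom_lsc, bhom_ract, bhom_rsc).
Defined.

Definition Mod : category.
Proof.
apply: (@Category (bimod A B) bimod_hom bimod_id bimod_comp);
  by move=> *; apply: bimod_hom_inj.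
Defined.
End BimodCategory.

Record ubimod (A B : pzRingType) := Ubimod {
  ubim :> zmodType;
  ubim_lact : A -> ubim -> ubim;
  ubim_ract : ubim -> B -> ubim;
  ubim_lmod : is_lmod ubim_lact;
  ubim_rmod : is_rmod ubim_ract;
  ubim_lact_ract : forall a m b,
    ubim_ract (ubim_lact a m) b = ubim_lact a (ubim_ract m b)
}.

Section UbimodCategory.
Variables (A B : pzRingType).
Implicit Types M N P : ubimod A B.

Record ubimod_hom M N := UbimodHom {
  uhom :> {additive M -> N};
  uhom_lact : forall a m, uhom (ubim_lact a m) = ubim_lact a (uhom m);
  uhom_ract : forall m b, uhom (ubim_ract m b) = ubim_ract (uhom m) b
}.

Fact ubimod_hom_inj M N (f g : ubimod_hom M N) : f =1 g -> f = g.
Proof.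
case: f g => [f f1 f2] [g g1 g2] /= /additive_inj efg.
by subst g; congr UbimodHom; apply: Prop_irrelevance.
Qed.

Definition ubimod_id M : ubimod_hom M M :=
  @UbimodHom M M idfun (fun _ _ => erefl) (fun _ _ => erefl).

Definition ubimod_comp M N P (g : ubimod_hom N P) (f : ubimod_hom M N) :
  ubimod_hom M P.
Proof.
by exists (g \o f : {additive M -> P}) => [a m|m b] /=;
  rewrite ?(uhom_lact, uhom_ract).
Defined.

Definition UMod : category.
Proof.
apply: (@Category (ubimod A B) ubimod_hom ubimod_id ubimod_comp);
  by move=> *; apply: ubimod_hom_inj.
Defined.
End UbimodCategory.

Section UnitalizationFunctor.
Variables (R S : comPzRingType) (A : nuAlgType R) (B : nuAlgType S).
Local Notation Ahat := (unitalization A).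
Local Notation Bhat := (unitalization B).

Section Object.
Variable M : bimod A B.

Definition F_lact (x : Ahat) (m : M) : M := bim_lact x.1 m + bim_lsc x.2 m.
Definition F_ract (m : M) (y : Bhat) : M := bim_ract m y.1 + bim_rsc m y.2.

Fact lact0 m : bim_lact (0 : A) m = 0 :> M.
Proof.
have [_ _ _ D _ _] := bim_lmod M.
by apply: (addrI (bim_lact 0 m)); rewrite -D !addr0.
Qed.

Fact ract0 m : bim_ract m (0 : B) = 0 :> M.
Proof.
have [_ _ _ D _ _] := bim_rmod M.
by apply: (addrI (bim_ract m 0)); rewrite -D !addr0.
Qed.

Fact F_lmod : is_lmod F_lact.
Proof.
have [[scA sc1 scDr scDl] actA actDr actDl scl scr] := bim_lmod M.
split=> [[a r] [b s] m | m | [a r] m n | [a r] [b s] m]; rewrite /F_lact /=.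
- rewrite actDr actA scDr scA scl !actDl -!addrA -scr; congr (_ + _).
  by rewrite addrCA.
- by rewrite lact0 add0r sc1.
- by rewrite actDr scDr addrACA.
- by rewrite actDl scDl addrACA.
Qed.

Fact F_rmod : is_rmod F_ract.
Proof.
have [[scA sc1 scDl scDr] actA actDl actDr scr scl] := bim_rmod M.
split=> [m [b s] [c t] | m | m n [b s] | m [b s] [c t]]; rewrite /F_ract /=.
- by rewrite actDl actA scDl scA scr !actDr -!addrA -scl.
- by rewrite ract0 add0r sc1.
- by rewrite actDl scDl addrACA.
- by rewrite actDr scDr addrACA.
Qed.

Fact F_lact_ract x m y : F_ract (F_lact x m) y = F_lact x (F_ract m y).
Proof.
have [[_ _ lscD _] _ lactD _ _ _] := bim_lmod M.
have [[_ _ rscD _] _ ractD _ _ _] := bim_rmod M.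
rewrite /F_ract /F_lact ractD rscD lactD lscD.
by rewrite bim_lact_ract bim_lsc_ract bim_lact_rsc bim_lsc_rsc addrACA.
Qed.

Definition F_obj : ubimod Ahat Bhat := Ubimod F_lmod F_rmod F_lact_ract.
End Object.

Section Morphism.
Variables (M N : bimod A B) (f : bimod_hom M N).

Fact F_hom_lact a m : f (F_lact a m) = F_lact a (f m).
Proof. by rewrite /F_lact raddfD bhom_lact bhom_lsc. Qed.

Fact F_hom_ract m b : f (F_ract m b) = F_ract (f m) b.
Proof. by rewrite /F_ract raddfD bhom_ract bhom_rsc. Qed.

Definition F_hom : ubimod_hom (F_obj M) (F_obj N) :=
  @UbimodHom _ _ (F_obj M) (F_obj N) (bhom f) F_hom_lact F_hom_ract.
End Morphism.

Definition unitalization_functor : functor (Mod A B) (UMod Ahat Bhat).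
Proof.
apply: (@Functor (Mod A B) (UMod Ahat Bhat) F_obj F_hom);
  by move=> *; apply: ubimod_hom_inj.
Defined.
End UnitalizationFunctor.

(* Main.v *)
Require Import Defs.
From HB Require Import structures.
From mathcomp Require Import all_boot all_algebra.
From mathcomp Require Import boolp.

(** The inverse functor restricts the scalars of a unital bimodule along the
    maps [a |-> (a, 0)] and [r |-> (0, r)] into the unitalizations; since
    [(a, r) = (a, 0) + (0, r)], the two constructions are mutually inverse.
    Both composites leave the underlying groups and maps definitionally
    unchanged, and this reduces the equalities of functors to equalities of
    scalar actions. *)

Set Implicit Arguments.
Unset Strict Implicit.
Unset Printing Implicit Defensive.

Import GRing.Theory.
Local Open Scope ring_scope.

(** The identity transported along [e], so that morphisms between equal but not convertible objects
    can be composed. *)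
Definition eqm (C : category) (x y : C) (e : x = y) : mor x y :=
  let: erefl := e in idm x.

(** Function extensionality turns [e] into an equality of object maps; once it is substituted, the
    naturality hypothesis says that [H] fixes every morphism. *)
Lemma functor_eq_id (C : category) (H : functor C C) (e : forall x, H x = x) :
  (forall x y (f : mor x y),
     compm (eqm (e y)) (fhom H f) = compm f (eqm (e x))) ->
  H = functor_id C.
Proof.
case: H e => ob hom hid hcomp /= e.
have eob : ob = (fun x => x) by apply/funext.
subst ob => natural_e.
have ehom : hom = (fun _ _ f => f).
  apply: functional_extensionality_dep => x.
  apply: functional_extensionality_dep => y.
  apply: functional_extensionality_dep => f.
  have := natural_e _ _ f.
  (* Each [e _] now proves an equality [x = x], so both transports are identities. *)
  by rewrite !(Prop_irrelevance (e _) erefl) /= comp1m compm1.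
by subst hom; congr Functor; apply: Prop_irrelevance.
Qed.

Definition zmod_cast (U V : zmodType) (e : U = V) : U -> V :=
  let: erefl := e in id.

Lemma zmod_cast_id (U : zmodType) (e : U = U) : zmod_cast e = id.
Proof. by rewrite (Prop_irrelevance e erefl). Qed.

Section UnitalizationEmbeddings.
Variables (R : comPzRingType) (A : nuAlgType R).
Implicit Types (a b : A) (r s : R).

Definition unit_alg a : unitalization A := (a, 0).
Definition unit_scal r : unitalization A := (0, r).

Lemma unit_algM a b : unit_alg a * unit_alg b = unit_alg (numul a b).
Proof. by congr pair; rewrite /= ?scale0r ?mulr0 ?addr0. Qed.

Lemma unit_scalM r s : unit_scal r * unit_scal s = unit_scal (r * s).
Proof. by congr pair; rewrite /= numul0l !scaler0 !addr0. Qed.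

(** This and the next product have the same value, whence [r.(a.m) = (r.a).m = a.(r.m)] after
    restriction. *)
Lemma unit_scal_algM r a : unit_scal r * unit_alg a = unit_alg (r *: a).
Proof. by congr pair; rewrite /= ?mulr0 // numul0l scaler0 addr0 add0r. Qed.

Lemma unit_alg_scalM a r : unit_alg a * unit_scal r = unit_alg (r *: a).
Proof. by congr pair; rewrite /= ?mul0r // numul0r scaler0 addr0 add0r. Qed.

Lemma unit_algD a b : unit_alg (a + b) = unit_alg a + unit_alg b.
Proof. by congr pair; rewrite /= addr0. Qed.

Lemma unit_scalD r s : unit_scal (r + s) = unit_scal r + unit_scal s.
Proof. by congr pair; rewrite /= addr0. Qed.

Lemma unit_algD_scal (x : unitalization A) : unit_alg x.1 + unit_scal x.2 = x.
Proof. by case: x => a r; congr pair; rewrite /= ?addr0 ?add0r. Qed.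

End UnitalizationEmbeddings.

Lemma lmod_act0 (R : pzRingType) (M : zmodType) (act : R -> M -> M) :
  is_lmod act -> forall m, act 0 m = 0.
Proof.
by case=> _ _ _ actDl m; apply: (addrI (act 0 m)); rewrite -actDl !addr0.
Qed.

Lemma rmod_act0 (S : pzRingType) (M : zmodType) (act : M -> S -> M) :
  is_rmod act -> forall m, act m 0 = 0.
Proof.
by case=> _ _ _ actDr m; apply: (addrI (act m 0)); rewrite -actDr !addr0.
Qed.

Section BimodEquality.
Variables (R S : comPzRingType) (A : nuAlgType R) (B : nuAlgType S).

(** With a common carrier [M] the actions are compared pointwise, without transport; the laws are
    propositions, hence irrelevant. *)
Lemma bimod_eq (M : zmodType) lsc lact rsc ract lsc' lact' rsc' ract'
    h1 h2 h3 h4 h5 h6 h1' h2' h3' h4' h5' h6' :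
    lsc =2 lsc' -> lact =2 lact' -> rsc =2 rsc' -> ract =2 ract' ->
  @Bimod R S A B M lsc lact rsc ract h1 h2 h3 h4 h5 h6 =
  @Bimod R S A B M lsc' lact' rsc' ract' h1' h2' h3' h4' h5' h6'.
Proof.
move=> /funeq2P ? /funeq2P ? /funeq2P ? /funeq2P ?.
by subst; congr Bimod; apply: Prop_irrelevance.
Qed.

(** As a map, the transport depends only on the induced equality of underlying groups. *)
Lemma eqm_bimodE (M N : Mod A B) (e : M = N) :
  (eqm e : bimod_hom M N) =1 zmod_cast (congr1 (@bim R S A B) e).
Proof. by case: N / e. Qed.

End BimodEquality.

Section UbimodEquality.
Variables (A B : pzRingType).

Lemma ubimod_eq (M : zmodType) lact ract lact' ract' h1 h2 h3 h1' h2' h3' :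
    lact =2 lact' -> ract =2 ract' ->
  @Ubimod A B M lact ract h1 h2 h3 = @Ubimod A B M lact' ract' h1' h2' h3'.
Proof.
move=> /funeq2P ? /funeq2P ?.
by subst; congr Ubimod; apply: Prop_irrelevance.
Qed.

Lemma eqm_ubimodE (M N : UMod A B) (e : M = N) :
  (eqm e : ubimod_hom M N) =1 zmod_cast (congr1 (@ubim A B) e).
Proof. by case: N / e. Qed.

End UbimodEquality.

Section RestrictionFunctor.
Variables (R S : comPzRingType) (A : nuAlgType R) (B : nuAlgType S).
Local Notation Ahat := (unitalization A).
Local Notation Bhat := (unitalization B).

Section Object.
Variable M : ubimod Ahat Bhat.

Definition G_lsc (r : R) (m : M) : M := ubim_lact (unit_scal A r) m.
Definition G_lact (a : A) (m : M) : M := ubim_lact (unit_alg a) m.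
Definition G_rsc (m : M) (s : S) : M := ubim_ract m (unit_scal B s).
Definition G_ract (m : M) (b : B) : M := ubim_ract m (unit_alg b).

Lemma G_lmod : is_nu_lmod G_lsc G_lact.
Proof.
have [actA act1 actDr actDl] := ubim_lmod M.
rewrite /G_lsc /G_lact; split; [split|..] => *.
- by rewrite actA unit_scalM.
(* [unit_scal A 1] is by conversion the unit [(0, 1)]. *)
- exact: act1.
- exact: actDr.
- by rewrite unit_scalD actDl.
- by rewrite actA unit_algM.
- exact: actDr.
- by rewrite unit_algD actDl.
- by rewrite actA unit_scal_algM.
- by rewrite actA unit_alg_scalM.
Qed.

Lemma G_rmod : is_nu_rmod G_rsc G_ract.
Proof.
have [actA act1 actDl actDr] := ubim_rmod M.
rewrite /G_rsc /G_ract; split; [split|..] => *.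
- by rewrite actA unit_scalM.
- exact: act1.
- exact: actDl.
- by rewrite unit_scalD actDr.
- by rewrite actA unit_algM.
- exact: actDl.
- by rewrite unit_algD actDr.
(* Right actions compose in the opposite order, so the two mixed products trade places. *)
- by rewrite actA unit_alg_scalM.
- by rewrite actA unit_scal_algM.
Qed.

Definition G_obj : bimod A B :=
  Bimod G_lmod G_rmod
    (fun _ _ _ => ubim_lact_ract _ _ _) (fun _ _ _ => ubim_lact_ract _ _ _)
    (fun _ _ _ => ubim_lact_ract _ _ _) (fun _ _ _ => ubim_lact_ract _ _ _).
End Object.

Definition G_hom (M N : ubimod Ahat Bhat) (f : ubimod_hom M N) :
  bimod_hom (G_obj M) (G_obj N) :=
  @BimodHom _ _ _ _ (G_obj M) (G_obj N) (uhom f)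
    (fun _ _ => uhom_lact f _ _) (fun _ _ => uhom_lact f _ _)
    (fun _ _ => uhom_ract f _ _) (fun _ _ => uhom_ract f _ _).

Definition restriction_functor : functor (UMod Ahat Bhat) (Mod A B).
Proof.
apply: (@Functor (UMod Ahat Bhat) (Mod A B) G_obj G_hom);
  by move=> *; apply: bimod_hom_inj.
Defined.

(** In [(0, r).m] and [(a, 0).m] one summand is an action of zero and vanishes; likewise on the
    right. *)
Lemma G_objK (M : bimod A B) : G_obj (F_obj M) = M.
Proof.
case: M => M lsc lact rsc ract hl hr h1 h2 h3 h4.
apply: bimod_eq => x y; rewrite /G_lsc /G_lact /G_rsc /G_ract /=.
- by rewrite /F_lact lact0 add0r.
- by rewrite /F_lact /= (lmod_act0 (nul_lmod hl)) addr0.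
- by rewrite /F_ract ract0 add0r.
- by rewrite /F_ract /= (rmod_act0 (nur_rmod hr)) addr0.
Qed.

(** Additivity in the scalar reassembles [(a, 0).m + (0, r).m] into [(a, r).m]. *)
Lemma F_objK (M : ubimod Ahat Bhat) : F_obj (G_obj M) = M.
Proof.
case: M => M lact ract hl hr h1.
apply: ubimod_eq => x y; rewrite /F_lact /F_ract /=.
- by rewrite /G_lact /G_lsc /= -(lscDl hl) unit_algD_scal.
- by rewrite /G_ract /G_rsc /= -(rscDr hr) unit_algD_scal.
Qed.

Lemma restriction_unitalizationK :
  functor_comp restriction_functor (unitalization_functor A B) =
  functor_id (Mod A B).
Proof.
apply: (@functor_eq_id _
  (functor_comp restriction_functor (unitalization_functor A B)) G_objK) => M N f.
(* The bimodules are only provably equal, but their groups are convertible, so each cast is along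
   some [U = U]. *)
by apply: bimod_hom_inj => m /=; rewrite !eqm_bimodE !zmod_cast_id.
Qed.

Lemma unitalization_restrictionK :
  functor_comp (unitalization_functor A B) restriction_functor =
  functor_id (UMod Ahat Bhat).
Proof.
apply: (@functor_eq_id _
  (functor_comp (unitalization_functor A B) restriction_functor) F_objK) => M N f.
by apply: ubimod_hom_inj => m /=; rewrite !eqm_ubimodE !zmod_cast_id.
Qed.

End RestrictionFunctor.

Theorem theorem3 (R S : comPzRingType) (A : nuAlgType R) (B : nuAlgType S) :
  is_category_iso (unitalization_functor A B).
Proof.
exists (restriction_functor A B); split.
- exact: restriction_unitalizationK.
- exact: unitalization_restrictionK.
Qed.
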